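(* Let $d$ be a positive integer and let $\{X_{\mathbf n}, \mathbf n\in\mathbb{Z}_+^d\}$ be a $d$-dimensional array of pairwise independent $\mathcal{H}$-valued random vectors. If the array of real-valued random variables $\{\|X_{\mathbf n}\|, \mathbf n\in\mathbb{Z}_+^d\}$ is uniformly integrable in the Cesàro sense, then $$\frac{\max_{\mathbf 1\prec\mathbf k\prec\mathbf n}\left\|\sum_{\mathbf i\prec\mathbf k}(X_{\mathbf i}-\mathbb{E}X_{\mathbf i})\right\|}{|\mathbf n|}\to 0 \quad\text{in } L_1 \text{ as } |\mathbf n|\to\infty .$$
   Context: $\mathcal{H}$ is a real separable Hilbert space with norm $\|\cdot\|$; all random vectors are defined on a common probability space $(\Omega,\mathcal{F},\mathbb{P})$, and $\mathbb{E}X_{\mathbf i}$ is the ($\mathcal{H}$-valued, Bochner) expectation. $\mathbb{Z}_+^d$ is the set of $d$-tuples of positive integers. For $\mathbf m=(m_1,\dots,m_d)$ and $\mathbf n=(n_1,\dots,n_d)$ in $\mathbb{Z}_+^d$, $\mathbf m\prec\mathbf n$ (equivalently $\mathbf n\succ\mathbf m$) means $m_i\le n_i$ for all $1\le i\le d$; $|\mathbf n|=\prod_{i=1}^d n_i$; $\mathbf 1=(1,\dots,1)$. Sums over $\mathbf i\prec\mathbf k$ run over $\mathbf i\in\mathbb{Z}_+^d$. A $d$-dimensional array of real-valued random variables $\{Y_{\mathbf n},\mathbf n\in\mathbb{Z}_+^d\}$ is uniformly integrable in the Cesàro sense if $$\lim_{a\to\infty}\ \sup_{\mathbf n\succ\mathbf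 1}\frac{1}{|\mathbf n|}\sum_{\mathbf i\prec\mathbf n}\mathbb{E}\big(|Y_{\mathbf i}|\,\mathbf 1(|Y_{\mathbf i}|>a)\big)=0,$$ where $\mathbf 1(\cdot)$ denotes the indicator function. Real random variables $W_{\mathbf n}$ converge to $0$ in $L_1$ as $|\mathbf n|\to\infty$ if $\mathbb{E}|W_{\mathbf n}|\to 0$ as $|\mathbf n|\to\infty$, i.e. for every $\varepsilon>0$ there is $M$ such that $\mathbb{E}|W_{\mathbf n}|<\varepsilon$ whenever $|\mathbf n|\ge M$. *)

(* Defs.v *)
(* MathComp-Analysis *)
From HB Require Import structures.
From mathcomp Require Import all_boot all_order all_algebra.
From mathcomp Require Import all_classical all_reals all_analysis.

Set Implicit Arguments.
Unset Strict Implicit.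
Unset Printing Implicit Defensive.

Import Order.TTheory GRing.Theory Num.Theory.
Import numFieldNormedType.Exports.

Local Open Scope classical_set_scope.
Local Open Scope ring_scope.

Definition posidx (d : nat) :=
  {n : {ffun 'I_d -> nat} | [forall j, (0 < n j)%N]}.

Definition prec (d : nat) (m n : posidx d) : bool :=
  [forall j, (val m j <= val n j)%N].

Definition vol (d : nat) (n : posidx d) : nat := (\prod_(j < d) val n j)%N.

(* Duplicate-free enumeration of the finite set of all i with [prec i n]: see
   [mem_box] and [box_uniq]. *)
Definition box (d : nat) (n : posidx d) : seq (posidx d) :=
  [seq i <- pmap insub [seq [ffun j => f j : nat] |
      f : {ffun 'I_d -> 'I_(\max_(j < d) val n j).+1}] | prec i n].

Lemma mem_box (d : nat) (n i : posidx d) : (i \in box n) = prec i n.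
Proof.
rewrite mem_filter; case: (boolP (prec i n)) => //= /forallP le_in.
rewrite mem_pmap; apply/mapP; exists (val i); last by rewrite valK.
have lt_i j : (val i j < (\max_(j < d) val n j).+1)%N.
  by rewrite ltnS (leq_trans (le_in j))// (leq_bigmax j).
apply/mapP; exists [ffun j => Ordinal (lt_i j)]; first by rewrite mem_enum.
by apply/ffunP => j; rewrite !ffunE.
Qed.

Lemma box_uniq (d : nat) (n : posidx d) : uniq (box n).
Proof.
apply: filter_uniq; apply: (@pmap_uniq _ _ _ val); first exact: insubK.
rewrite map_inj_uniq ?enum_uniq// => f g /ffunP fg.
by apply/ffunP => j; apply: val_inj; have := fg j; rewrite !ffunE.
Qed.

(* Any inner product inducing the norm of the complete space H makes H a
   Hilbert space. *)
Definition induces_norm (R : realType) (H : normedModType R)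
    (ip : {dot H for (@idfun R)}) : Prop :=
  forall x : H, ip x x = `|x| ^+ 2.

Definition separable (T : topologicalType) : Prop :=
  exists2 A : set T, countable A & dense A.

Notation borel H := (g_sigma_algebraType (@open H)).

Section RandomVectors.
Context (R : realType) (H : normedModType R) (dT : measure_display)
        (T : measurableType dT) (P : probability T R).

Definition random_vector (X : T -> H) : Prop :=
  measurable_fun [set: T] (X : T -> borel H).

Definition independent2 (X Y : T -> H) : Prop :=
  forall A B : set (borel H), measurable A -> measurable B ->
  P (X @^-1` A `&` Y @^-1` B) = (P (X @^-1` A) * P (Y @^-1` B))%E.

Definition pairwise_independent (I : Type) (X : I -> T -> H) : Prop :=
  forall i j : I, i <> j -> independent2 (X i) (X j).

Definition simple (s : T -> H) : Prop :=
  random_vector s /\ finite_set (range s).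

Definition simple_expectation (s : T -> H) : H :=
  \sum_(x \in range s) fine (P (s @^-1` [set x])) *: x.

(* In a separable space Borel measurability is strong measurability, so this is
   the usual definition of Bochner integrability with integral v. *)
Definition is_bochner_expectation (X : T -> H) (v : H) : Prop :=
  random_vector X /\
  exists s : nat -> T -> H,
    [/\ forall k, simple (s k),
        (fun k => 'E_P[fun w => (`|X w - s k w|)%R]%E) @ \oo --> 0%E
      & (fun k => simple_expectation (s k)) @ \oo --> v].

(* Takes the junk value 0 when X is not Bochner integrable. *)
Definition bochner_expectation (X : T -> H) : H :=
  xget 0 [set v | is_bochner_expectation X v].

End RandomVectors.

Definition cesaro_uniformly_integrable (R : realType) (d : nat)
    (dT : measure_display) (T : measurableType dT) (P : probability T R)
    (Y : posidx d -> T -> R) : Prop :=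
  (fun a : R => ereal_sup (range (fun n : posidx d =>
     (((vol n)%:R^-1)%:E * \sum_(i <- box n)
        'E_P[fun w => (`|Y i w| * \1_[set u | a < `|Y i u|] w)%R])%E)))
    @ +oo --> 0%E.

Definition cvg0_L1 (R : realType) (d : nat)
    (dT : measure_display) (T : measurableType dT) (P : probability T R)
    (W : posidx d -> T -> R) : Prop :=
  forall eps : R, 0 < eps -> exists M : nat, forall n : posidx d,
    (M <= vol n)%N -> ('E_P[fun w => `|W n w|%R] < eps%:E)%E.

(* The norms being nonnegative and [box n] nonempty, the initial value 0 of the
   iterated maximum is immaterial. *)
Definition max_partial_sum (R : realType) (H : normedModType R) (d : nat)
    (Z : posidx d -> H) (n : posidx d) : R :=
  \big[Num.max/0]_(k <- box n) `|\sum_(i <- box k) Z i|.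

(* Main.v *)
(* Each X_i is approximated in L1, on average over the box, by a vector
   Y_i = phi_i(X_i) with finitely many values and bounded by a constant that
   does not depend on i; uniform integrability controls the truncation error and
   separability the discretization error.  The centred vectors
   Z_i = Y_i - E Y_i are bounded by c and pairwise orthogonal.  No maximal
   inequality is needed for them: moving k up to a grid with L steps per
   coordinate changes the sum of the Z_i by at most c d |n| / L, and at each of
   the at most (L+1)^d grid points the second moment of the sum is at most
   c^2 |n|, which is o(|n|^2). *)
Require Import Defs.
From mathcomp Require Import all_boot all_order all_algebra.
From mathcomp Require Import all_classical all_reals all_analysis.
From mathcomp Require Import measurable_realfun.
From mathcomp Require Import zify ring lra.
Set Implicit Arguments.
Unset Strict Implicit.
Unset Printing Implicit Defensive.
Import Order.TTheory GRing.Theory Num.Theory.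
Import numFieldNormedType.Exports.
Local Open Scope classical_set_scope.
Local Open Scope ring_scope.

(** * Boxes and partial sums *)

Lemma size_box (d : nat) (n : posidx d) : size (box n) = vol n.
Proof.
set m := (\max_(j < d) val n j)%N.
have lem j : (val n j <= m)%N by rewrite /m (leq_bigmax j).
pose F (j : 'I_d) : pred 'I_m.+1 := [pred x : 'I_m.+1 | (0 < x <= val n j)%N].
have cardF j : #|F j| = val n j.
  have := cardD1 ord0 [pred x : 'I_m.+1 | (x < (val n j).+1)%N].
  have -> : #|[pred x : 'I_m.+1 | (x < (val n j).+1)%N]| = (val n j).+1.
    rewrite -sum1_card -(big_ord_widen m.+1 (fun=> 1%N)) ?ltnS//=.
    by rewrite sum1_card card_ord.
  rewrite inE /= add1n => -[->]; apply: eq_card => x.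
  by rewrite !inE -(inj_eq val_inj) /= ltnS lt0n.
have -> : vol n = #|family F|.
  rewrite card_family foldrE big_map big_enum /=.
  by apply: eq_bigr => j _; rewrite cardF.
rewrite cardE -(size_map (fun f : {ffun 'I_d -> 'I_m.+1} =>
   [ffun j => f j : nat])).
rewrite -(size_map (val : posidx d -> {ffun 'I_d -> nat}) (box n)).
apply: perm_size; apply: uniq_perm.
- by rewrite (map_inj_uniq val_inj) box_uniq.
- rewrite map_inj_uniq ?enum_uniq// => f g /ffunP fg.
  by apply/ffunP => j; apply: val_inj; have := fg j; rewrite !ffunE.
move=> g; apply/mapP/mapP => [[i + ->]|[f + ->]].
  rewrite mem_box => /forallP lein.
  have lt_i j : (val i j < m.+1)%N by rewrite ltnS (leq_trans (lein j)).
  exists [ffun j => Ordinal (lt_i j)].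
    rewrite mem_enum; apply/familyP => j; rewrite ffunE inE /= lein andbT.
    by have /forallP := valP i.
  by apply/ffunP => j; rewrite !ffunE.
rewrite mem_enum => /familyP Ff.
have fpos : [forall j, (0 < [ffun j => f j : nat] j)%N].
  by apply/forallP => j; rewrite ffunE; have := Ff j; rewrite inE => /andP[].
exists (exist (fun g : {ffun 'I_d -> nat} => [forall j, (0 < g j)%N]) _ fpos) => //.
rewrite mem_box; apply/forallP => j /=.
by rewrite ffunE; have := Ff j; rewrite inE => /andP[].
Qed.

Lemma precxx (d : nat) (n : posidx d) : prec n n.
Proof. by apply/forallP. Qed.

Lemma prec_trans (d : nat) (m n p : posidx d) : prec m n -> prec n p -> prec m p.
Proof.
by move=> /forallP mn /forallP np; apply/forallP => j; apply: leq_trans (np j).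
Qed.

Lemma vol_gt0 (d : nat) (n : posidx d) : (0 < vol n)%N.
Proof. by apply: prodn_gt0 => j; have /forallP := valP n. Qed.

Lemma leq_vol (d : nat) (m n : posidx d) : prec m n -> (vol m <= vol n)%N.
Proof. by move=> /forallP mn; apply: leq_prod. Qed.

Lemma prod_sub_le_sum (R : realDomainType) (I : Type) (r : seq I)
    (x y : I -> R) :
  (forall i, 0 <= y i <= x i) -> (forall i, x i <= 1) ->
  \prod_(i <- r) x i - \prod_(i <- r) y i <= \sum_(i <- r) (x i - y i).
Proof.
move=> yx x1.
suff: [&& \prod_(i <- r) x i - \prod_(i <- r) y i <= \sum_(i <- r) (x i - y i),
          0 <= \prod_(i <- r) y i <= \prod_(i <- r) x i &
          \prod_(i <- r) x i <= 1] by case/andP.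
elim: r => [|i r IHr]; first by rewrite !big_nil subrr lexx ler01 lexx.
rewrite !big_cons; move: IHr (yx i) (x1 i).
move: (\prod_(j <- r) x j) (\prod_(j <- r) y j) (\sum_(j <- r) (x j - y j)).
move=> p q s /and3P[pq /andP[q0 qp] p1] /andP[yi0 yxi] xi1.
by apply/and3P; split; [nra | apply/andP; split; nra | nra].
Qed.

(* Rounding [k j] up to the floor of a multiple of [n j / L] costs at most
   [n j / L], even when [n j < L]; the [maxn 1] only keeps the unused value
   [f j = 0] inside [posidx d]. *)
Definition gridpt (d L : nat) (n : posidx d) (f : {ffun 'I_d -> 'I_L.+1}) :
  posidx d := insubd n [ffun j => maxn 1 (f j * val n j %/ L)].

Lemma gridptE (d L : nat) (n : posidx d) (f : {ffun 'I_d -> 'I_L.+1}) j :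
  val (gridpt n f) j = maxn 1 (f j * val n j %/ L).
Proof.
rewrite /gridpt /insubd insubT ?ffunE//=.
  by apply/forallP => i; rewrite ffunE leq_max.
by move=> ?; rewrite ffunE.
Qed.

Lemma prec_gridpt (d L : nat) (n : posidx d) (f : {ffun 'I_d -> 'I_L.+1}) :
  (0 < L)%N -> prec (gridpt n f) n.
Proof.
move=> L0; apply/forallP => j; rewrite gridptE geq_max.
have /forallP/(_ j) -> /= := valP n.
rewrite -[X in (_ <= X)%N](mulKn _ L0) leq_div2r// leq_mul2r.
by have := ltn_ord (f j); rewrite ltnS => ->; rewrite orbT.
Qed.

Lemma gridpt_round (d L : nat) (n k : posidx d) : (0 < L)%N -> prec k n ->
  exists f : {ffun 'I_d -> 'I_L.+1}, prec k (gridpt n f) /\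
    forall j, (val (gridpt n f) j * L <= val k j * L + val n j)%N.
Proof.
move=> L0 /forallP kn.
have n0 j : (0 < val n j)%N by have /forallP := valP n.
have k0 j : (0 < val k j)%N by have /forallP := valP k.
pose t j := ((val k j * L + (val n j).-1) %/ val n j)%N.
have tL j : (t j < L.+1)%N.
  rewrite /t ltn_divLR//; have := kn j; have := n0 j.
  by move: (val n j) (val k j) => a b; nia.
have kt j : (val k j * L <= t j * val n j)%N.
  have := ltn_ceil (val k j * L + (val n j).-1) (n0 j); rewrite -/(t j).
  by have := n0 j; move: (val n j) (val k j) (t j) => a b c; nia.
have tk j : (t j * val n j <= val k j * L + val n j)%N.
  apply: leq_trans (leq_trunc_div _ _) _; lia.
have kg j : (val k j <= t j * val n j %/ L)%N by rewrite leq_divRL.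
exists [ffun j => Ordinal (tL j)]; split; [apply/forallP => j|move=> j];
  rewrite gridptE ffunE /=.
  by rewrite leq_max kg orbT.
rewrite (maxn_idPr _); last exact: leq_trans (kg j).
exact: leq_trans (leq_trunc_div _ _) (tk j).
Qed.

Lemma vol_gridpt_sub (R : realFieldType) (d L : nat) (n k g : posidx d) :
  (0 < L)%N -> prec k g -> prec g n ->
  (forall j, (val g j * L <= val k j * L + val n j)%N) ->
  (vol g)%:R - (vol k)%:R <= d%:R / L%:R * (vol n)%:R :> R.
Proof.
move=> L0 /forallP kg /forallP gn gk.
have n0 j : (0 : R) < (val n j)%:R by rewrite ltr0n; have /forallP := valP n.
have L0' : (0 : R) < L%:R by rewrite ltr0n.
have vn0 : (0 : R) < (vol n)%:R by rewrite ltr0n vol_gt0.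
rewrite -ler_pdivrMr// mulrBl.
have volE (m : posidx d) :
    (vol m)%:R / (vol n)%:R = \prod_(j < d) ((val m j)%:R / (val n j)%:R) :> R.
  by rewrite /vol !natr_prod prodf_div.
rewrite !volE; apply: le_trans (prod_sub_le_sum _ _ _) _.
- move=> j; rewrite divr_ge0 ?ler0n// ler_pM2r ?invr_gt0//.
  by rewrite ler_nat kg.
- by move=> j; rewrite ler_pdivrMr// mul1r ler_nat gn.
rewrite -[d in leRHS]card_ord -sum1_card natr_sum mulr_suml ler_sum// => j _.
rewrite mul1r -mulrBl ler_pdivrMr// ler_pdivlMl//.
have : ((val g j * L)%:R <= (val k j * L + val n j)%:R :> R) by rewrite ler_nat.
by rewrite natrD !natrM; move: (_ %:R) (_ %:R) (_ %:R) => a b c; lra.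
Qed.

Lemma perm_box_filter (d : nat) (k g : posidx d) : prec k g ->
  perm_eq (box k) [seq i <- box g | prec i k].
Proof.
move=> kg; apply: uniq_perm; [exact: box_uniq| |move=> i].
  exact: filter_uniq (box_uniq _).
rewrite mem_box mem_filter mem_box; case: (boolP (prec i k)) => //= ik.
by rewrite (prec_trans ik kg).
Qed.

Lemma sum_box_prec (V : nmodType) (d : nat) (k g : posidx d)
    (F : posidx d -> V) : prec k g ->
  \sum_(i <- box k) F i = \sum_(i <- box g | prec i k) F i.
Proof.
by move=> kg; rewrite (perm_big _ (perm_box_filter kg)); exact: big_filter.
Qed.

Lemma norm_sum_box_diff (R : realType) (H : normedModType R) (d : nat)
    (Z : posidx d -> H) (c : R) (k g : posidx d) :
  (forall i, `|Z i| <= c) -> prec k g ->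
  `|\sum_(i <- box g) Z i - \sum_(i <- box k) Z i| <=
    c * ((vol g)%:R - (vol k)%:R).
Proof.
move=> Zc kg; rewrite (sum_box_prec _ kg) (bigID (fun i => prec i k)) /=.
rewrite [X in `|X - _|]addrC addrK (le_trans (ler_norm_sum _ _ _))//.
rewrite (le_trans (ler_sum _ (fun i _ => Zc i)))//.
rewrite big_const_seq iter_addr_0 -[leLHS]mulr_natr.
have kE : size (box k) = count (fun i => prec i k) (box g).
  by rewrite (perm_size (perm_box_filter kg)); exact: size_filter.
rewrite -!size_box kE -(count_predC (fun i => prec i k)) natrD.
by rewrite [X in X - _]addrC addrK.
Qed.

Lemma max_partial_sum_le (R : realType) (H : normedModType R) (d : nat)
    (Z : posidx d -> H) (n : posidx d) (B : R) : 0 <= B ->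
  (forall k, prec k n -> `|\sum_(i <- box k) Z i| <= B) ->
  max_partial_sum Z n <= B.
Proof.
move=> B0 ZB; rewrite /max_partial_sum big_seq.
by elim/big_ind: _ => //[x y xB yB|k]; rewrite ?ge_max ?xB// mem_box; exact: ZB.
Qed.

Lemma le_max_partial_sum (R : realType) (H : normedModType R) (d : nat)
    (Z : posidx d -> H) (n k : posidx d) : prec k n ->
  `|\sum_(i <- box k) Z i| <= max_partial_sum Z n.
Proof.
by rewrite -mem_box => kn; rewrite /max_partial_sum; 
exact: (@le_bigmax_seq _ _ _ _ 0 k xpredT (fun k => `|\sum_(i <- box k) Z i|)).
Qed.

Lemma max_partial_sum_ge0 (R : realType) (H : normedModType R) (d : nat)
    (Z : posidx d -> H) (n : posidx d) : 0 <= max_partial_sum Z n.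
Proof. exact: bigmax_ge_id. Qed.

Lemma max_partial_sumD (R : realType) (H : normedModType R) (d : nat)
    (A Z : posidx d -> H) (n : posidx d) :
  max_partial_sum (fun i => A i + Z i) n <=
    \sum_(i <- box n) `|A i| + max_partial_sum Z n.
Proof.
apply: max_partial_sum_le => [|k kn].
  by rewrite addr_ge0 ?sumr_ge0 ?max_partial_sum_ge0.
rewrite big_split (le_trans (ler_normD _ _))// lerD ?le_max_partial_sum//.
rewrite (le_trans (ler_norm_sum _ _ _))//.
rewrite (sum_box_prec _ kn).
by rewrite [leRHS](bigID (fun i => prec i k)) /= lerDl sumr_ge0.
Qed.

Lemma max_partial_sum_grid (R : realType) (H : normedModType R) (d L : nat)
    (Z : posidx d -> H) (c : R) (n : posidx d) : (0 < L)%N ->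
  (forall i, `|Z i| <= c) ->
  max_partial_sum Z n <=
    \sum_(f : {ffun 'I_d -> 'I_L.+1}) `|\sum_(i <- box (gridpt n f)) Z i|
    + c * (d%:R / L%:R * (vol n)%:R).
Proof.
move=> L0 Zc; have c0 : 0 <= c := le_trans (normr_ge0 _) (Zc n).
apply: max_partial_sum_le => [|k kn].
  by rewrite addr_ge0 ?sumr_ge0 ?mulr_ge0 ?invr_ge0 ?ler0n.
have [f [kf fk]] := gridpt_round L0 kn.
rewrite (bigD1 f)//= -addrA.
rewrite -[X in `|X|](addrNK (\sum_(i <- box (gridpt n f)) Z i)).
rewrite (le_trans (ler_normD _ _))// [leLHS]addrC lerD2l.
rewrite -[leLHS]add0r lerD ?sumr_ge0//.
rewrite distrC (le_trans (norm_sum_box_diff Zc kf))// ler_wpM2l//.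
by apply: vol_gridpt_sub; rewrite ?prec_gridpt.
Qed.

(** * Finitely valued random elements *)

(* The integral of a nonnegative function is a supremum over its simple
   minorants, so it is monotone even on nonmeasurable functions. *)
Lemma ge0_le_expectation (R : realType) (dT : measure_display)
    (T : measurableType dT) (P : probability T R) (f g : T -> R) :
  (forall w, 0 <= f w) -> (forall w, f w <= g w) -> ('E_P[f] <= 'E_P[g])%E.
Proof.
move=> f0 fg; have g0 w : 0 <= g w := le_trans (f0 w) (fg w).
rewrite unlock !ge0_integralTE; try by move=> w; rewrite lee_fin.
apply: le_ereal_sup => _ [h /= hf <-]; exists h => //= w.
by rewrite (le_trans (hf w))// lee_fin.
Qed.

Lemma ge0_expectationD (R : realType) (dT : measure_display)
    (T : measurableType dT) (P : probability T R) (f g : T -> R) :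
  measurable_fun setT f -> measurable_fun setT g ->
  (forall w, 0 <= f w) -> (forall w, 0 <= g w) ->
  ('E_P[fun w => (f w + g w)%R] = 'E_P[f] + 'E_P[g])%E.
Proof.
move=> mf mg f0 g0; rewrite unlock -ge0_integralD//.
- by move=> w _; rewrite lee_fin.
- exact/measurable_EFinP.
- by move=> w _; rewrite lee_fin.
- exact/measurable_EFinP.
Qed.

Lemma ge0_expectationZl (R : realType) (dT : measure_display)
    (T : measurableType dT) (P : probability T R) (k : R) (f : T -> R) :
  0 <= k -> measurable_fun setT f -> (forall w, 0 <= f w) ->
  ('E_P[fun w => (k * f w)%R] = k%:E * 'E_P[f])%E.
Proof.
move=> k0 mf f0; rewrite unlock -ge0_integralZl_EFin//.
- by move=> w _; rewrite lee_fin.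
- exact/measurable_EFinP.
Qed.

Lemma ge0_expectation_sum (R : realType) (dT : measure_display)
    (T : measurableType dT) (P : probability T R) (I : Type) (r : seq I)
    (f : I -> T -> R) :
  (forall i, measurable_fun setT (f i)) -> (forall i w, 0 <= f i w) ->
  ('E_P[fun w => (\sum_(i <- r) f i w)%R] = \sum_(i <- r) 'E_P[f i])%E.
Proof.
move=> mf f0; rewrite unlock -ge0_integral_sum//.
- by apply: eq_integral => w _; rewrite sumEFin.
- by move=> i; exact/measurable_EFinP.
- by move=> i w _; rewrite lee_fin.
Qed.

Lemma expectation_cst_fun (R : realType) (dT : measure_display)
    (T : measurableType dT) (P : probability T R) (k : R) :
  ('E_P[fun=> k] = k%:E)%E.
Proof. exact: expectation_cst. Qed.

Definition finitely_valued (dT : measure_display) (T : measurableType dT)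
    (K : Type) (u : T -> K) : Prop :=
  finite_set (range u) /\ forall z, measurable (u @^-1` [set z]).

Lemma finitely_valued_measurable (dT dU : measure_display)
    (T : measurableType dT) (U : measurableType dU) (K : Type) (u : T -> K)
    (F : K -> T -> U) :
  finitely_valued u -> (forall z, measurable_fun setT (F z)) ->
  measurable_fun setT (fun w => F (u w) w).
Proof.
move=> [finu mu] mF _ B mB; rewrite setTI.
have -> : (fun w => F (u w) w) @^-1` B =
    \bigcup_(z in range u) (u @^-1` [set z] `&` F z @^-1` B).
  apply/seteqP; split => [w Bw|w [z _ [/= <-]]//].
  by exists (u w); [exists w|].
apply: fin_bigcup_measurable => // z _; apply: measurableI; first exact: mu.
by rewrite -[X in measurable X]setTI; exact: mF.
Qed.

Lemma finitely_valued_preimage (dT : measure_display) (T : measurableType dT)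
    (K : Type) (u : T -> K) (A : set K) :
  finitely_valued u -> measurable (u @^-1` A).
Proof.
move=> fu; have := finitely_valued_measurable
  (F := fun z (_ : T) => `[< A z >]) fu (fun z => measurable_cst _).
move=> /(_ measurableT [set true] I); rewrite setTI.
by congr (measurable _); apply/seteqP; split => w /asboolP.
Qed.

Lemma finitely_valued_comp (dT : measure_display) (T : measurableType dT)
    (K L : Type) (u : T -> K) (g : K -> L) :
  finitely_valued u -> finitely_valued (g \o u).
Proof.
move=> fu; split; last first.
  by move=> z; exact: (@finitely_valued_preimage _ _ _ u (g @^-1` [set z])).
by rewrite -(image_comp u g); apply: finite_image; case: fu.
Qed.

Lemma finitely_valued_pair (dT : measure_display) (T : measurableType dT)
    (K L : Type) (u : T -> K) (v : T -> L) :
  finitely_valued u -> finitely_valued v ->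
  finitely_valued (fun w => (u w, v w)).
Proof.
move=> [fu mu] [fv mv]; split.
  apply: sub_finite_set (finite_setX fu fv) => _ [w _ <-] /=.
  by split; exists w.
move=> [x y]; have -> : (fun w => (u w, v w)) @^-1` [set (x, y)] =
    u @^-1` [set x] `&` v @^-1` [set y].
  by apply/seteqP; split => w /=; [case=> -> ->|case=> -> ->].
exact: measurableI.
Qed.

Lemma finitely_valued_if (dT : measure_display) (T : measurableType dT)
    (K : Type) (b : T -> bool) (u v : T -> K) : measurable_fun setT b ->
  finitely_valued u -> finitely_valued v ->
  finitely_valued (fun w => if b w then u w else v w).
Proof.
move=> mb fu fv.
have fb : finitely_valued b.
  split; first exact: finite_finset.
  by move=> z; rewrite -[X in measurable X]setTI; exact: mb.
have := finitely_valued_comp (fun z => if z.1 then z.2.1 else z.2.2)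
  (finitely_valued_pair fb
     (finitely_valued_pair fu fv)).
exact.
Qed.

Lemma finitely_valued_range (dT : measure_display) (T : measurableType dT)
    (K : choiceType) (u : T -> K) : finitely_valued u ->
  exists r : seq K, uniq r /\ forall w, u w \in r.
Proof.
move=> [/finite_seqP[r rE] _]; exists (undup r); split; first exact: undup_uniq.
move=> w; rewrite mem_undup.
by have : range u (u w) by []; rewrite rE.
Qed.

Section FinitelyValuedExpectation.
Context (R : realType) (dT : measure_display) (T : measurableType dT)
  (P : probability T R) (K : choiceType) (u : T -> K) (r : seq K).
Hypotheses (fu : finitely_valued u) (ur : uniq r) (ru : forall w, u w \in r).

Let p (z : K) : R := fine (P (u @^-1` [set z])).

Let finP (A : set T) : measurable A -> P A \is a fin_num.
Proof. by move=> mA; exact: fin_num_measure. Qed.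

Let indic_sum (V : lmodType R) (h : K -> V) w :
  h (u w) = \sum_(z <- r) (\1_(u @^-1` [set z]) w : R) *: h z.
Proof.
rewrite (bigD1_seq (u w))//= indicE mem_set// scale1r big1 ?addr0//.
by move=> z zu; rewrite indicE memNset ?scale0r//= => uz; rewrite uz eqxx in zu.
Qed.

Lemma finitely_valued_integrable (h : K -> R) :
  P.-integrable setT (fun w => (h (u w))%:E).
Proof.
have -> : (fun w => (h (u w))%:E) =
    (fun w => \sum_(z <- r) ((h z)%:E * (\1_(u @^-1` [set z]) w)%:E))%E.
  apply/funext => w; rewrite (indic_sum (h : K -> R^o)) -sumEFin.
  by apply: eq_bigr => z _; rewrite -EFinM mulrC.
apply: integrable_sum => // z _; apply: integrableZl => //.
by apply: integrable_indic; case: fu.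
Qed.

Lemma finitely_valued_expectation (h : K -> R) :
  ('E_P[fun w => h (u w)] = (\sum_(z <- r) p z * h z)%:E)%E.
Proof.
rewrite unlock.
transitivity (\int[P]_w (\sum_(z <- r) ((h z)%:E * (\1_(u @^-1` [set z]) w)%:E)))%E.
  apply: eq_integral => w _; rewrite (indic_sum (h : K -> R^o)) -sumEFin.
  by apply: eq_bigr => z _; rewrite -EFinM mulrC.
have ii z : P.-integrable setT (fun w => (\1_(u @^-1` [set z]) w : R)%:E).
  by apply: integrable_indic; case: fu.
rewrite integral_sum//; last by move=> z; exact: integrableZl.
rewrite -sumEFin; apply: eq_bigr => z _; rewrite integralZl//.
have mz : measurable (u @^-1` [set z]) by case: fu.
by rewrite integral_indic// setIT EFinM muleC /p fineK// finP.
Qed.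

Lemma sum_prob_fibers : \sum_(z <- r) p z = 1.
Proof.
apply: EFin_inj; rewrite -(expectation_cst_fun P 1).
rewrite (finitely_valued_expectation (fun=> 1)); congr EFin.
by apply: eq_bigr => z _; rewrite mulr1.
Qed.

Lemma simple_expectation_comp (H : normedModType R) (g : K -> H) :
  simple_expectation P (g \o u) = \sum_(z <- r) p z *: g z.
Proof.
have fiberE x : fine (P ((g \o u) @^-1` [set x])) =
    \sum_(z <- r) p z * (g z == x)%:R.
  have mx : measurable ((g \o u) @^-1` [set x]).
    exact: (@finitely_valued_preimage _ _ _ u (g @^-1` [set x])).
  apply: EFin_inj; rewrite fineK ?finP//.
  rewrite -(finitely_valued_expectation (fun z => (g z == x)%:R)) unlock.
  rewrite -[X in P X]setIT -integral_indic//; apply: eq_integral => w _.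
  by rewrite indicE; congr ((_ (_ : bool))%:R%:E); apply/idP/eqP;
    rewrite inE.
rewrite /simple_expectation.
have subr : range (g \o u) `<=` [set` undup (map g r)].
  by move=> _ [w _ <-] /=; rewrite mem_undup map_f.
rewrite (fsbig_widen _ _ _ subr); last first.
  move=> x [_ /= Nx]; rewrite (_ : _ @^-1` _ = set0) ?measure0 ?scale0r//.
  by apply/seteqP; split => // w gw; apply: Nx; exists w.
rewrite -fsbig_seq ?undup_uniq//.
under eq_bigr do rewrite fiberE scaler_suml.
rewrite exchange_big /= big_seq [RHS]big_seq; apply: eq_bigr => z zr.
rewrite (bigD1_seq (g z)) ?undup_uniq ?mem_undup ?map_f//= eqxx mulr1.
rewrite big1 ?addr0// => x; rewrite eq_sym => /negbTE ->.
by rewrite mulr0 scale0r.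
Qed.

End FinitelyValuedExpectation.

(** * Bochner expectation *)

Section SimpleVectors.
Context (R : realType) (H : normedModType R).
Context (dT : measure_display) (T : measurableType dT) (P : probability T R).
Implicit Types (s t X : T -> H).

Lemma measurable_borel_set1 (z : H) : measurable ([set z] : set (borel H)).
Proof.
rewrite -[X in measurable X]setCK; apply: measurableC.
apply: sub_sigma_algebra; rewrite openC.
by apply: accessible_closed_set1; apply: hausdorff_accessible; exact: norm_hausdorff.
Qed.

Lemma simple_finitely_valued s : simple s -> finitely_valued s.
Proof.
move=> [ms fs]; split=> // z; rewrite -[X in measurable X]setTI.
by apply: (ms measurableT); exact: measurable_borel_set1.
Qed.

Lemma finitely_valued_simple s : finitely_valued s -> simple s.
Proof.
move=> fs; split; last by case: fs.
by move=> _ B _; rewrite setTI; exact: finitely_valued_preimage.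
Qed.

Lemma measurable_norm_borel (c : H) :
  measurable_fun setT (fun x : borel H => `|(x : H) - c|).
Proof.
apply: (measurability _ (RGenOInfty.measurableE R)) => _ [_ [y ->] <-].
rewrite setTI; apply: sub_sigma_algebra.
apply: (@open_comp _ _ (fun x : H => `|x - c|)); last exact: interval_open.
by move=> x _; apply: cvg_norm; apply: cvgB; [exact: cvg_id|exact: cvg_cst].
Qed.

Lemma measurable_norm_sub X (c : H) :
  random_vector X -> measurable_fun setT (fun w => `|X w - c|).
Proof. by move=> mX; exact: (measurableT_comp (measurable_norm_borel c) mX). Qed.

Lemma measurable_norm_sub_simple X s : random_vector X -> simple s ->
  measurable_fun setT (fun w => `|X w - s w|).
Proof.
move=> mX /simple_finitely_valued fs.
apply: (finitely_valued_measurable (F := fun z w => `|X w - z|)) => // z.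
exact: measurable_norm_sub.
Qed.

Lemma norm_simple_expectationB s t : simple s -> simple t ->
  ((`|simple_expectation P s - simple_expectation P t|)%:E <=
   'E_P[fun w => `|s w - t w|%R])%E.
Proof.
move=> /simple_finitely_valued fs /simple_finitely_valued ft.
have fu := finitely_valued_pair fs ft.
have [r [ur ru]] := finitely_valued_range fu.
rewrite (simple_expectation_comp P fu ur ru fst).
rewrite (simple_expectation_comp P fu ur ru snd).
rewrite (finitely_valued_expectation P fu ur ru (fun z => `|z.1 - z.2|)).
rewrite lee_fin -sumrB (le_trans (ler_norm_sum _ _ _))// ler_sum// => z _.
by rewrite -scalerBr normrZ ger0_norm// fine_ge0.
Qed.

Lemma norm_simple_expectation s : simple s ->
  ((`|simple_expectation P s|)%:E <= 'E_P[fun w => `|s w|%R])%E.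
Proof.
move=> /simple_finitely_valued fs.
have [r [ur ru]] := finitely_valued_range fs.
rewrite (simple_expectation_comp P fs ur ru id).
rewrite (finitely_valued_expectation P fs ur ru (fun z => `|z|)).
rewrite lee_fin (le_trans (ler_norm_sum _ _ _))// ler_sum// => z _.
by rewrite normrZ ger0_norm// fine_ge0.
Qed.

Lemma expectation_dist_triangle X s t :
  random_vector X -> simple s -> simple t ->
  ('E_P[fun w => `|s w - t w|%R] <=
   'E_P[fun w => `|X w - s w|%R] + 'E_P[fun w => `|X w - t w|%R])%E.
Proof.
move=> mX ss st; rewrite -ge0_expectationD//; last 2 first.
- exact: measurable_norm_sub_simple.
- exact: measurable_norm_sub_simple.
apply: ge0_le_expectation => // w.
by rewrite -[s w - t w](subrKA (X w)) (le_trans (ler_normD _ _))// distrC.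
Qed.

End SimpleVectors.

Section Bochner.
Context (R : realType) (H : completeNormedModType R).
Context (dT : measure_display) (T : measurableType dT) (P : probability T R).

Lemma is_bochner_expectation_exists (X : T -> H) : random_vector X ->
  (forall e : R, 0 < e -> exists2 s, simple s &
     ('E_P[fun w => `|X w - s w|%R] <= e%:E)%E) ->
  exists v, is_bochner_expectation P X v.
Proof.
move=> mX aX.
have /choice[s sE] (k : nat) : exists s, simple s /\
    ('E_P[fun w => `|X w - s w|%R] <= (k.+1%:R^-1)%:E)%E.
  by have [|s ? ?] := aX (k.+1%:R^-1); [rewrite invr_gt0|exists s].
have cvgE : (fun k => 'E_P[fun w => (`|X w - s k w|)%R]%E) @ \oo --> 0%E.
  apply: (@squeeze_cvge _ _ _ _ (cst 0%E) _ (fun k => (k.+1%:R^-1)%:E)).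
  - near=> k; rewrite expectation_ge0//=; exact: (sE k).2.
  - exact: cvg_cst.
  - exact: cvge_harmonic.
have /cauchy_cvgP/cvg_ex[v Ev] :
    cauchy ((fun k => simple_expectation P (s k)) @ \oo).
  apply: cauchy_exP => e e0.
  have [N Ne] : exists N : nat, N.+1%:R^-1 + N.+1%:R^-1 < e.
    have e20 : 0 < e / 2 by rewrite divr_gt0.
    have [N _ /(_ N (leqnn N)) /= Ne] := near_infty_natSinv_lt (PosNum e20).
    by exists N; rewrite [e]splitr ltrD.
  exists (simple_expectation P (s N)), N => //= k Nk.
  rewrite -ball_normE /ball_ /= (le_lt_trans _ Ne)// -lee_fin EFinD.
  rewrite (le_trans (norm_simple_expectationB P (sE N).1 (sE k).1))//.
  rewrite (le_trans (expectation_dist_triangle P mX (sE N).1 (sE k).1))//.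
  rewrite leeD//; first exact: (sE N).2.
  apply: le_trans (sE k).2 _; rewrite lee_fin lef_pV2 ?posrE ?ltr0n//.
  by rewrite ler_nat ltnS.
exists v; split=> //; exists s; split=> // k; exact: (sE k).1.
Unshelve. all: by end_near.
Qed.

Lemma bochner_expectation_dist (X s : T -> H) : random_vector X ->
  (forall e : R, 0 < e -> exists2 s, simple s &
     ('E_P[fun w => `|X w - s w|%R] <= e%:E)%E) -> simple s ->
  ((`|bochner_expectation P X - simple_expectation P s|)%:E <=
   'E_P[fun w => `|X w - s w|%R])%E.
Proof.
move=> mX aX ss; have [v0 hv0] := is_bochner_expectation_exists mX aX.
have [_ [t [st cvgt Et]]] : is_bochner_expectation P X (bochner_expectation P X).
  by apply: (@xgetPex _ 0 [set v | is_bochner_expectation P X v]); exists v0.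
set v := bochner_expectation P X in Et *.
apply/lee_addgt0Pr => e e0; have e20 : 0 < e / 2 by rewrite divr_gt0.
have [k [kX kE]] : exists k, ('E_P[fun w => `|X w - t k w|%R] <= (e / 2)%:E)%E /\
    `|v - simple_expectation P (t k)| <= e / 2.
  move: cvgt => /fine_cvgP[tfin /cvgr0Pnorm_le/(_ _ e20) t0].
  move: Et => /cvgrPdist_le/(_ _ e20) tv.
  have [k _ /(_ k (leqnn k))/= [[fk t0k] tvk]] := filterI (filterI tfin t0) tv.
  exists k; split=> //; rewrite -(fineK fk) lee_fin.
  exact: le_trans (ler_norm _) t0k.
apply: (@le_trans _ _ ((`|v - simple_expectation P (t k)|)%:E +
    (`|simple_expectation P (t k) - simple_expectation P s|)%:E)%E).
  by rewrite -EFinD lee_fin -[v - _](subrKA (simple_expectation P (t k))) ler_normD.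
have -> : ('E_P[fun w => `|X w - s w|%R] + e%:E = (e / 2)%:E +
    ((e / 2)%:E + 'E_P[fun w => `|X w - s w|%R]))%E.
  by rewrite addeA -EFinD -splitr addeC.
rewrite leeD ?lee_fin//.
rewrite (le_trans (norm_simple_expectationB P (st k) ss))//.
rewrite (le_trans (expectation_dist_triangle P mX (st k) ss))//.
by rewrite leeD.
Qed.

End Bochner.

(** * Approximation and second moments *)

Section Approximation.
Context (R : realType) (H : normedModType R).

Fixpoint nearest (xs : nat -> H) (N : nat) (x : H) : H :=
  if N is n.+1 then
    if `|x - xs n| < `|x - nearest xs n x| then xs n else nearest xs n x
  else 0.

Lemma norm_sub_nearest (xs : nat -> H) (N : nat) (x : H) :
  `|x - nearest xs N x| <= `|x|.
Proof.
by elim: N => [|N IHN] /=; [rewrite subr0|case: ifPn => // /ltW /le_trans; exact].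
Qed.

Lemma nearest_le (xs : nat -> H) (N m : nat) (x : H) : (m < N)%N ->
  `|x - nearest xs N x| <= `|x - xs m|.
Proof.
elim: N => // N IHN; rewrite ltnS leq_eqVlt => /orP[/eqP ->|/IHN le_m] /=.
  by case: ifPn => //; rewrite -leNgt.
by case: ifPn => // /ltW /le_trans; exact.
Qed.

Lemma finitely_valued_cst (dT : measure_display) (T : measurableType dT)
    (K : Type) (z : K) : finitely_valued (fun _ : T => z).
Proof.
split; first exact: (finite_image_cst z).
by move=> y; rewrite preimage_cst; case: ifP => _ //; exact: measurable0.
Qed.

Lemma finitely_valued_nearest (xs : nat -> H) (N : nat) :
  finitely_valued (nearest xs N : borel H -> H).
Proof.
elim: N => [|N IHN] /=; first exact: finitely_valued_cst.
apply: finitely_valued_if => //; last exact: finitely_valued_cst.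
apply: measurable_fun_ltr; first exact: measurable_norm_borel.
apply: (finitely_valued_measurable (F := fun z (x : borel H) => `|(x : H) - z|)).
  exact: IHN.
by move=> z; exact: measurable_norm_borel.
Qed.

Lemma separable_seq : separable H ->
  exists xs : nat -> H, forall x e, 0 < e -> exists n, `|x - xs n| < e.
Proof.
move=> [A /countable_injP[f finj] dA].
exists (fun n => xget 0 [set x | A x /\ f x = n]) => x e e0.
have [y [xy Ay]] : ball x e `&` A !=set0.
  apply: dA; last exact: ball_open.
  by exists x; exact: ballxx.
exists (f y); case: xgetP => [z _ [Az fz]|/(_ y)]; last by case.
have -> : z = y by apply: finj; rewrite ?inE.
by move: xy; rewrite -ball_normE.
Qed.

Lemma simple_approximation (dT : measure_display) (T : measurableType dT)
    (P : probability T R) (X : T -> H) (a e : R) :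
  separable H -> random_vector X -> 0 <= a -> 0 < e ->
  exists phi : borel H -> H, [/\ finitely_valued phi,
    forall x, `|phi x| <= 2 * a &
    ('E_P[fun w => `|X w - phi (X w)|%R] <=
     'E_P[fun w => (`|X w| * \1_[set u | (a < `|X u|)%R] w)%R] + e%:E)%E].
Proof.
move=> /separable_seq[xs xsP] mX a0 e0.
have mn : measurable_fun setT (fun x : borel H => `|(x : H)|).
  have := @measurable_norm_borel R H 0; congr (measurable_fun _ _).
  by apply/funext => x; rewrite subr0.
have mnX : measurable_fun setT (fun w => `|X w|) := measurableT_comp mn mX.
have mle : measurable_fun setT (fun x : borel H => `|(x : H)| <= a).
  exact: measurable_fun_ler.
pose psi N (x : borel H) := if `|(x : H)| <= a then nearest xs N x else 0.
have fpsi N : finitely_valued (psi N).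
  apply: finitely_valued_if => //; first exact: finitely_valued_nearest.
  exact: finitely_valued_cst.
pose g N (x : borel H) := if `|(x : H)| <= a then `|(x : H) - nearest xs N x| else 0.
have mg N : measurable_fun setT (g N).
  apply: measurable_fun_ifT => //.
  apply: (finitely_valued_measurable (F := fun z (x : borel H) => `|(x : H) - z|)).
    exact: finitely_valued_nearest.
  by move=> z; exact: measurable_norm_borel.
have mgX N : measurable_fun setT (g N \o X) := measurableT_comp (mg N) mX.
have g0 N x : 0 <= g N x by rewrite /g; case: ifP.
have ga N x : g N x <= a.
  by rewrite /g; case: ifPn => // /(le_trans _); apply; exact: norm_sub_nearest.
have [|||||_ _] := @dominated_convergence _ _ _ P setT measurableT
    (fun N w => (g N (X w))%:E) (cst 0%E) (cst a%:E).
- by move=> N; apply/measurable_EFinP; exact: mgX.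
- exact: measurable_cst.
- apply: aeW => w _; apply: cvg_EFin; first exact: nearW.
  apply/cvgr0Pnorm_le => d d0 /=.
  have [n xn] := xsP (X w) d d0.
  exists n.+1 => //= N /= nN; rewrite ger0_norm//= /g.
  case: ifP => _; last exact: ltW.
  by rewrite (le_trans (nearest_le _ _ nN))// ltW.
- exact: finite_measure_integrable_cst.
- by apply: aeW => w N _ /=; rewrite lee_fin ger0_norm.
rewrite integral0 => /fine_cvgP[gfin /cvgr0Pnorm_le/(_ _ e0) ge].
have [N _ /(_ N (leqnn N)) /= [Nfin Ne]] := filterI gfin ge.
have {Nfin Ne} gNe : ('E_P[g N \o X] <= e%:E)%E.
  by rewrite unlock -(fineK Nfin) lee_fin (le_trans (ler_norm _)).
exists (psi N); split=> //.
  move=> x; rewrite /psi; case: ifPn => xa; last by rewrite normr0 mulr_ge0.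
  rewrite -[nearest _ _ _](subKr x) (le_trans (ler_normB _ _))//.
  by rewrite mulrDl mul1r lerD// (le_trans (norm_sub_nearest _ _ _)).
apply: le_trans (leeD2l _ gNe); rewrite -ge0_expectationD//; last 2 first.
- apply: measurable_funM => //; apply: measurable_indic.
  have mlt : measurable_fun setT (fun w => a < `|X w|) by exact: measurable_fun_ltr.
  by have := mlt measurableT [set true] I; rewrite setTI.
- by move=> w; exact: g0.
apply: ge0_le_expectation => // w; rewrite /psi /g /= indicE.
case: ifPn => xa; first by rewrite lerDr mulr_ge0.
by rewrite mem_set ?mulr1 ?addr0 ?subr0//= ltNge.
Qed.

End Approximation.

Section SecondMoment.
Context (R : realType) (H : normedModType R) (ip : {dot H for (@idfun R)}).
Hypothesis hip : induces_norm ip.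
Context (dT : measure_display) (T : measurableType dT) (P : probability T R).

Definition independent_fibers (K : Type) (s t : T -> K) : Prop :=
  forall x y, P (s @^-1` [set x] `&` t @^-1` [set y]) =
    (P (s @^-1` [set x]) * P (t @^-1` [set y]))%E.

Lemma expectation_ip_independent (s t : T -> H) : simple s -> simple t ->
  independent_fibers s t ->
  ('E_P[fun w =>
     ip (s w - simple_expectation P s)%R (t w - simple_expectation P t)%R] = 0)%E.
Proof.
move=> /simple_finitely_valued fs /simple_finitely_valued ft ist.
have fu := finitely_valued_pair fs ft.
have [r [ur rs]] := finitely_valued_range fs.
have [q [uq qt]] := finitely_valued_range ft.
have urq : uniq [seq (x, y) | x <- r, y <- q].
  by apply: allpairs_uniq => // -[? ?] [? ?].
have rqst w : (s w, t w) \in [seq (x, y) | x <- r, y <- q].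
  by apply: allpairs_f.
pose h z := ip (z.1 - simple_expectation P s) (z.2 - simple_expectation P t).
rewrite (finitely_valued_expectation P fu urq rqst h); congr EFin.
rewrite big_allpairs exchange_big /= big1// => y _.
have sumE : \sum_(x <- r) fine (P (s @^-1` [set x])) *: (x - simple_expectation P s)
    = 0.
  under eq_bigr do rewrite scalerBr.
  rewrite sumrB -scaler_suml (sum_prob_fibers P fs ur rs) scale1r.
  by rewrite -(simple_expectation_comp P fs ur rs id) subrr.
transitivity (fine (P (t @^-1` [set y])) *
  ip (\sum_(x <- r) fine (P (s @^-1` [set x])) *: (x - simple_expectation P s))
     (y - simple_expectation P t)); last by rewrite sumE linear0l mulr0.
rewrite linear_sumlz mulr_sumr; apply: eq_bigr => x _.
have -> : (fun w => (s w, t w)) @^-1` [set (x, y)] =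
    s @^-1` [set x] `&` t @^-1` [set y].
  by apply/seteqP; split => w /=; [case=> -> ->|case=> -> ->].
rewrite ist fineM ?fin_num_measure//; [|by case: fs|by case: ft].
have ipZ k v v' : ip (k *: v) v' = k * ip v v' by exact: linearZl_LR.
apply: etrans (congr1 ( *%R _) (esym (ipZ _ _ _))).
by rewrite /h /= [RHS]mulrCA mulrA.
Qed.

Lemma finitely_valued_sum (I : Type) (r : seq I) (V : nmodType) (s : I -> T -> V) :
  (forall i, finitely_valued (s i)) ->
  finitely_valued (fun w => \sum_(i <- r) s i w).
Proof.
move=> fs; elim: r => [|i r IHr].
  rewrite (_ : (fun w => _) = fun=> 0); first exact: finitely_valued_cst.
  by apply/funext => w; rewrite big_nil.
rewrite (_ : (fun w => _) = fun w => s i w + \sum_(j <- r) s j w); last first.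
  by apply/funext => w; rewrite big_cons.
exact: (finitely_valued_comp (fun z => z.1 + z.2) (finitely_valued_pair (fs i) IHr)).
Qed.

Lemma second_moment_sum (I : eqType) (r : seq I) (s : I -> T -> H) (c : R) :
  uniq r -> (forall i, simple (s i)) ->
  (forall i j, i != j -> independent_fibers (s i) (s j)) ->
  (forall i w, `|s i w - simple_expectation P (s i)| <= c) ->
  ('E_P[fun w => (`|\sum_(i <- r) (s i w - simple_expectation P (s i))| ^+ 2)%R] <=
   (c ^+ 2 * (size r)%:R)%:E)%E.
Proof.
move=> ur ss si sc; pose Z i w := s i w - simple_expectation P (s i).
have iZ i j : P.-integrable setT (fun w => (ip (Z i w) (Z j w))%:E).
  have fu := finitely_valued_pair (simple_finitely_valued (ss i))
    (simple_finitely_valued (ss j)).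
  have [q [uq qt]] := finitely_valued_range fu.
  exact: (finitely_valued_integrable P fu uq qt (fun z =>
    ip (z.1 - simple_expectation P (s i)) (z.2 - simple_expectation P (s j)))).
have -> : ('E_P[fun w => (`|\sum_(i <- r) Z i w| ^+ 2)%R] =
    \sum_(i <- r) \sum_(j <- r) 'E_P[fun w => ip (Z i w) (Z j w)])%E.
  rewrite unlock; transitivity (\int[P]_w (\sum_(i <- r) \sum_(j <- r)
      (ip (Z i w) (Z j w))%:E))%E.
    apply: eq_integral => w _; rewrite -hip linear_sumlz -sumEFin.
    by apply: eq_bigr => i _; rewrite linear_sumr -sumEFin.
  rewrite integral_sum//; last by move=> i; apply: integrable_sum.
  by apply: eq_bigr => i _; rewrite integral_sum.
have -> : c ^+ 2 * (size r)%:R = \sum_(i <- r) c ^+ 2.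
  by rewrite big_const_seq count_predT iter_addr_0 mulr_natr.
rewrite -sumEFin big_seq [leRHS]big_seq; apply: lee_sum => i ir.
rewrite (bigD1_seq i)//= big1 ?adde0; last first.
  by move=> j ji; apply: expectation_ip_independent => //; apply: si; rewrite eq_sym.
rewrite -(expectation_cst_fun P); apply: ge0_le_expectation => w.
  by rewrite hip exprn_ge0.
by rewrite hip lerXn2r ?nnegrE// (le_trans _ (sc i w)).
Qed.

End SecondMoment.

(** * The law of large numbers *)

Lemma expectation_max_partial_sum (R : realType) (H : normedModType R)
    (ip : {dot H for (@idfun R)}) (dT : measure_display) (T : measurableType dT)
    (P : probability T R) (d : nat) (X Y : posidx d -> T -> H)
    (m : posidx d -> H) (err : posidx d -> R) (c delta : R) (L : nat)
    (n : posidx d) :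
  induces_norm ip -> (forall i, random_vector (X i)) ->
  (forall i, simple (Y i)) ->
  (forall i j, i != j -> independent_fibers P (Y i) (Y j)) ->
  (forall i w, `|Y i w - simple_expectation P (Y i)| <= c) ->
  (forall i, ('E_P[fun w => `|X i w - Y i w|%R] <= (err i)%:E)%E) ->
  (forall i, `|m i - simple_expectation P (Y i)| <= err i) ->
  0 <= c -> 0 < delta -> (0 < L)%N ->
  ('E_P[fun w => (max_partial_sum (fun i => X i w - m i) n / (vol n)%:R)%R] <=
   ((vol n)%:R^-1 * (\sum_(i <- box n) (err i + err i)) +
    ((L.+1 ^ d)%:R * (delta + c ^+ 2 / (4 * delta * (vol n)%:R)) +
     c * (d%:R / L%:R)))%:E)%E.
Proof.
move=> hip mX sY iY Yc XY mY c0 delta0 L0.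
set V : R := (vol n)%:R; have V0 : 0 < V by rewrite ltr0n vol_gt0.
pose Z i w := Y i w - simple_expectation P (Y i).
pose S (f : {ffun 'I_d -> 'I_L.+1}) w := \sum_(i <- box (gridpt n f)) Z i w.
pose A w := V^-1 * \sum_(i <- box n)
  (`|X i w - Y i w| + `|m i - simple_expectation P (Y i)|).
pose k := (4 * delta * V ^+ 2)^-1.
have k0 : 0 <= k by rewrite invr_ge0 !mulr_ge0 ?sqr_ge0// ltW.
pose B w := \sum_(f : {ffun 'I_d -> 'I_L.+1}) (delta + k * `|S f w| ^+ 2).
have mXY i : measurable_fun setT (fun w => `|X i w - Y i w|).
  exact: measurable_norm_sub_simple.
have mS f : measurable_fun setT (fun w => `|S f w| ^+ 2).
  have fS : finitely_valued (S f).
    apply: finitely_valued_sum => i.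
    exact: (finitely_valued_comp (fun y => y - simple_expectation P (Y i))
      (simple_finitely_valued (sY i))).
  pose F (z : H) (_ : T) : R := `|z| ^+ 2.
  have mF z : measurable_fun setT (F z) by exact: measurable_cst.
  exact: (finitely_valued_measurable fS mF).
have WAB w : max_partial_sum (fun i => X i w - m i) n / V <=
    A w + (B w + c * (d%:R / L%:R)).
  rewrite ler_pdivrMr// mulrDl [A w * V]mulrAC mulVf ?gt_eqF// mul1r.
  have -> : (fun i => X i w - m i) = (fun i =>
      (X i w - Y i w - (m i - simple_expectation P (Y i))) + Z i w).
    by apply/funext => i; rewrite /Z opprB [RHS]addrACA subrK addrAC subrr sub0r.
  apply: le_trans (max_partial_sumD _ _ _) _; apply: lerD.
    by apply: ler_sum => i _; exact: ler_normB.
  apply: le_trans (max_partial_sum_grid n L0 (fun i => Yc i w)) _.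
  rewrite mulrDl lerD//; last by rewrite mulrA.
  rewrite mulr_suml; apply: ler_sum => f _; rewrite -/(Z _ _) -/(S f w) mulrDl.
  (* AM-GM: [|S| <= delta V + |S|^2 / (4 delta V)] *)
  have := sqr_ge0 (`|S f w| - 2 * delta * V).
  have -> : k * `|S f w| ^+ 2 * V = `|S f w| ^+ 2 / (4 * delta * V).
    by rewrite /k; field; rewrite !gt_eqF.
  move: `|S f w| => x hx.
  rewrite -lerBlDl ler_pdivlMr ?mulr_gt0//.
  nra.
have sumge0 w : 0 <= \sum_(i <- box n)
    (`|X i w - Y i w| + `|m i - simple_expectation P (Y i)|).
  by apply: sumr_ge0 => i _; rewrite addr_ge0.
apply: (@le_trans _ _ ('E_P[fun w => (A w + (B w + c * (d%:R / L%:R)))%R])%E).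
  apply: ge0_le_expectation => // w.
  by rewrite divr_ge0 ?max_partial_sum_ge0// ltW.
have mA : measurable_fun setT A.
  apply: measurable_funM => //; apply: measurable_sum => i.
  exact: measurable_funD.
have mB0 f : measurable_fun setT (fun w => delta + k * `|S f w| ^+ 2).
  by apply: measurable_funD => //; exact: measurable_funM.
have B0 f w : 0 <= delta + k * `|S f w| ^+ 2.
  by rewrite addr_ge0 ?mulr_ge0 ?sqr_ge0// ltW.
have mB : measurable_fun setT B by exact: measurable_sum.
have C0 : 0 <= c * (d%:R / L%:R) by rewrite mulr_ge0 ?divr_ge0.
rewrite ge0_expectationD//; last 3 first.
- exact: measurable_funD.
- by move=> w; rewrite mulr_ge0// invr_ge0 ltW.
- by move=> w; rewrite addr_ge0// sumr_ge0.
rewrite EFinD leeD//.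
  rewrite ge0_expectationZl ?invr_ge0 ?(ltW V0)//; last first.
    by apply: measurable_sum => i; exact: measurable_funD.
  rewrite EFinM  lee_wpmul2l ?lee_fin ?invr_ge0 ?(ltW V0)//.
  rewrite ge0_expectation_sum//; last first.
    by move=> i; exact: measurable_funD.
  rewrite -sumEFin lee_sum// => i _.
  by rewrite ge0_expectationD// expectation_cst_fun EFinD leeD// lee_fin.
rewrite ge0_expectationD// ?expectation_cst_fun; last first.
  by move=> w; exact: sumr_ge0.
rewrite EFinD leeD2r// ge0_expectation_sum//.
have -> : ((L.+1 ^ d)%:R * (delta + c ^+ 2 / (4 * delta * V))) =
    \sum_(f : {ffun 'I_d -> 'I_L.+1}) (delta + c ^+ 2 / (4 * delta * V)).
  by rewrite sumr_const card_ffun !card_ord mulr_natl.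
rewrite -sumEFin lee_sum// => f _.
rewrite ge0_expectationD//; last 3 first.
- exact: measurable_funM.
- by move=> _; exact: ltW.
- by move=> w; rewrite mulr_ge0// sqr_ge0.
rewrite expectation_cst_fun EFinD leeD2l// ge0_expectationZl//.
apply: (@le_trans _ _ (k%:E * (c ^+ 2 * V)%:E)%E).
  rewrite lee_wpmul2l ?lee_fin//.
  apply: le_trans (second_moment_sum hip (box_uniq _) sY iY Yc) _.
  by rewrite lee_fin ler_wpM2l ?sqr_ge0// size_box ler_nat leq_vol// prec_gridpt.
rewrite -EFinM lee_fin le_eqVlt; apply/orP; left; apply/eqP.
by rewrite /k; field; rewrite !gt_eqF.
Qed.

Lemma simple_comp_random_vector (R : realType) (H : normedModType R)
    (dT : measure_display) (T : measurableType dT) (X : T -> H)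
    (phi : borel H -> H) :
  random_vector X -> finitely_valued phi -> simple (phi \o X).
Proof.
move=> mX [fphi mphi]; apply: finitely_valued_simple; split.
  by apply: sub_finite_set fphi => _ [w _ <-]; exists (X w).
move=> z; rewrite -[X in measurable X]setTI.
by have := mX measurableT _ (mphi z).
Qed.

Lemma cesaro_uniformly_integrable_tails (R : realType) (d : nat)
    (dT : measure_display) (T : measurableType dT) (P : probability T R)
    (Y : posidx d -> T -> R) (e : R) :
  cesaro_uniformly_integrable P Y -> 0 < e ->
  exists a (tail : posidx d -> R), [/\ 0 < a,
    forall i, ('E_P[fun w => (`|Y i w| * \1_[set u | (a < `|Y i u|)%R] w)%R] =
      (tail i)%:E)%E &
    forall n, \sum_(i <- box n) tail i <= e * (vol n)%:R].
Proof.
move=> /fine_cvgP[Ffin /cvgr0Pnorm_le Fe] e0.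
have [a [[Fa Fae] a0]] := filter_ex
  (filterI (filterI Ffin (Fe _ e0)) (nbhs_pinfty_gt (num_real (0 : R)))).
pose E i := ('E_P[fun w => (`|Y i w| * \1_[set u | (a < `|Y i u|)%R] w)%R])%E.
have E0 i : (0 <= E i)%E by apply: expectation_ge0 => w; rewrite mulr_ge0.
have sumE n : (\sum_(i <- box n) E i <= (e * (vol n)%:R)%:E)%E.
  have V0 : 0 < (vol n)%:R :> R by rewrite ltr0n vol_gt0.
  rewrite mulrC EFinM -lee_pdivrMl//.
  apply: le_trans (_ : (fine _)%:E <= e%:E)%E; last first.
    by rewrite lee_fin; exact: le_trans (ler_norm _) Fae.
  by rewrite fineK//; apply: ereal_sup_ubound; exists n.
have Efin i : E i \is a fin_num.
  rewrite ge0_fin_numE// (le_lt_trans _ (ltry (e * (vol i)%:R)))//.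
  apply: le_trans (sumE i).
  by rewrite (bigD1_seq i) ?box_uniq ?mem_box ?precxx//= leeDl// sume_ge0.
exists a, (fun i => fine (E i)); split=> // [i|n]; first by rewrite fineK.
rewrite -lee_fin -sumEFin; apply: le_trans (sumE n).
by apply: lee_sum => i _; rewrite fineK.
Qed.

Theorem theorem2 (R : realType) (H : completeNormedModType R)
    (ip : {dot H for (@idfun R)}) (hip : induces_norm ip)
    (hsep : separable H)
    (dT : measure_display) (T : measurableType dT) (P : probability T R)
    (d : nat) (hd : (0 < d)%N) (X : posidx d -> T -> H)
    (hX : forall n : posidx d, random_vector (X n))
    (hindep : pairwise_independent P X)
    (hui : cesaro_uniformly_integrable P
             (fun (n : posidx d) (w : T) => `|X n w|)) :
  cvg0_L1 P (fun (n : posidx d) (w : T) =>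
    max_partial_sum
      (fun i : posidx d => X i w - bochner_expectation P (X i)) n
      / (vol n)%:R).
Proof.
move=> eps eps0.
have tails (e : R) : 0 < e -> exists a (tail : posidx d -> R), [/\ 0 < a,
    forall i, ('E_P[fun w => (`|X i w| * \1_[set u | (a < `|X i u|)%R] w)%R] =
      (tail i)%:E)%E &
    forall n, \sum_(i <- box n) tail i <= e * (vol n)%:R].
  move=> e0; have [a [tail [a0 tailE tailn]]] :=
    cesaro_uniformly_integrable_tails hui e0.
  exists a, tail; split=> // i; rewrite -tailE; congr expectation.
  have -> : [set u | a < `|(`|X i u|)|] = [set u | a < `|X i u|].
    by apply/seteqP; split=> u /=; rewrite normr_id.
  by apply/funext => w; rewrite normr_id.
have approx i (e : R) : 0 < e -> exists2 s, simple s &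
    ('E_P[fun w => `|X i w - s w|%R] <= e%:E)%E.
  move=> e0; have e20 : 0 < e / 2 by rewrite divr_gt0.
  have V0 : 0 < (vol i)%:R :> R by rewrite ltr0n vol_gt0.
  have [a [tail [a0 tailE tailn]]] := tails _ (divr_gt0 e20 V0).
  have [phi [fphi _ phiE]] := simple_approximation P hsep (hX i) (ltW a0) e20.
  exists (phi \o X i); first exact: simple_comp_random_vector.
  apply: (le_trans phiE); rewrite tailE -EFinD lee_fin [leRHS]splitr lerD2r.
  have -> : e / 2 = e / 2 / (vol i)%:R * (vol i)%:R by rewrite divfK ?gt_eqF.
  apply: le_trans (tailn i).
  rewrite (bigD1_seq i) ?box_uniq ?mem_box ?precxx//= lerDl sumr_ge0// => j _.
  rewrite -lee_fin -tailE; apply: expectation_ge0 => w.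
  by rewrite mulr_ge0.
pose eta := eps / 32.
have eta0 : 0 < eta by rewrite divr_gt0.
have [a [tail [a0 tailE tailn]]] := tails _ eta0.
have /choice[phi phiP] (i : posidx d) :=
  simple_approximation P hsep (hX i) (ltW a0) eta0.
pose Y i w := phi i (X i w).
have sY i : simple (Y i).
  by have [fphi _ _] := phiP i; exact: simple_comp_random_vector.
have iY i j : i != j -> independent_fibers P (Y i) (Y j).
  move=> /eqP ij x y.
  apply: (hindep _ _ ij (phi i @^-1` [set x]) (phi j @^-1` [set y])).
    by have [[_ +] _ _] := phiP i; exact.
  by have [[_ +] _ _] := phiP j; exact.
have XY i : ('E_P[fun w => `|X i w - Y i w|%R] <= (tail i + eta)%:E)%E.
  by have [_ _] := phiP i; rewrite tailE -EFinD.
have Ya i w : `|Y i w| <= 2 * a by have [_ + _] := phiP i; exact.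
have Yc i w : `|Y i w - simple_expectation P (Y i)| <= 4 * a.
  rewrite (le_trans (ler_normB _ _))// (_ : 4 * a = 2 * a + 2 * a); last by ring.
  rewrite lerD// -lee_fin (le_trans (norm_simple_expectation P (sY i)))//.
  by rewrite -(expectation_cst_fun P); exact: ge0_le_expectation.
have mY i :
    `|bochner_expectation P (X i) - simple_expectation P (Y i)| <= tail i + eta.
  rewrite -lee_fin; apply: le_trans (XY i).
  exact: bochner_expectation_dist (hX i) (approx i) (sY i).
have c0 : 0 <= 4 * a by rewrite mulr_ge0// ltW.
have [L L0 Le] : exists2 L, (0 < L)%N & 4 * a * (d%:R / L%:R) <= eps / 4.
  pose L := (Num.truncn (16 * a * d%:R / eps)).+1.
  exists L => //; have L0 : 0 < L%:R :> R by rewrite ltr0n.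
  have := truncnS_gt (16 * a * d%:R / eps); rewrite -/L => /ltW.
  rewrite !mulrA !ler_pdivrMr//.
  move: (L%:R : R) (d%:R : R) => l dd h; lra.
set K : R := (L.+1 ^ d)%:R.
have K0 : 0 < K by rewrite ltr0n expn_gt0.
pose delta := eps / (4 * K).
have delta0 : 0 < delta by rewrite divr_gt0// mulr_gt0.
pose q := K * (4 * a) ^+ 2 / (delta * eps).
exists (Num.truncn q).+1 => n Mn.
have V0 : 0 < (vol n)%:R :> R by rewrite ltr0n vol_gt0.
have qV : q < (vol n)%:R.
  by apply: lt_le_trans (truncnS_gt q) _; rewrite ler_nat.
have -> : (fun w => `|max_partial_sum
    (fun i => X i w - bochner_expectation P (X i)) n / (vol n)%:R|) = (fun w => max_partial_sum
    (fun i => X i w - bochner_expectation P (X i)) n / (vol n)%:R).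
  by apply/funext => w; rewrite ger0_norm// divr_ge0 ?max_partial_sum_ge0.
apply: le_lt_trans
  (expectation_max_partial_sum n hip hX sY iY Yc XY mY c0 delta0 L0) _.
rewrite lte_fin -/K.
have h1 : (vol n)%:R^-1 *
    (\sum_(i <- box n) (tail i + eta + (tail i + eta))) <= eps / 8.
  rewrite ler_pdivrMl// !big_split /= big_const_seq count_predT size_box iter_addr_0.
  rewrite -[eta *+ _]mulr_natr; have := tailn n; rewrite /eta.
  move: (\sum_(i <- _) _) ((vol n)%:R : R) => s v hs; lra.
have h2 : K * (delta + (4 * a) ^+ 2 / (4 * delta * (vol n)%:R)) <= eps / 2.
  have -> : K * (delta + (4 * a) ^+ 2 / (4 * delta * (vol n)%:R)) =
      eps / 4 + q / (vol n)%:R * (eps / 4).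
    by rewrite /q /delta; field; rewrite !gt_eqF.
  have : q / (vol n)%:R <= 1 by rewrite ler_pdivrMr// mul1r ltW.
  by move: (q / _) => z; nra.
by lra.
Qed.
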